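(* For all integers $n\geq 0$, $$a_{1^{-1}2^{3}4^{-1}5^{-2}}(5n)>0,\quad a_{1^{-1}2^{3}4^{-1}5^{-2}}(5n+1)>0,\quad a_{1^{-1}2^{3}4^{-1}5^{-2}}(5n+2)<0,$$ $$a_{1^{-1}2^{3}4^{-1}5^{-2}}(5n+3)=0,\quad a_{1^{-1}2^{3}4^{-1}5^{-2}}(5n+4)=0.$$
   Context: For $|q|<1$ (or as formal power series in $q$) let $f_j:=(q^j;q^j)_\infty=\prod_{k\ge 1}(1-q^{jk})$ for each positive integer $j$. The integers $a_{1^{-1}2^{3}4^{-1}5^{-2}}(n)$, $n\ge 0$, are defined by $\sum_{n=0}^\infty a_{1^{-1}2^{3}4^{-1}5^{-2}}(n)q^n=\dfrac{f_2^3}{f_1f_4f_5^2}$. *)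

(* Defs.v *)
From HB Require Import structures.
From mathcomp Require Import all_boot all_order all_algebra.

Set Implicit Arguments.
Unset Strict Implicit.
Unset Printing Implicit Defensive.

Import Order.TTheory GRing.Theory Num.Theory.
Local Open Scope ring_scope.

(* A formal power series over the integers is its sequence of coefficients:
   [a] stands for \sum_(n >= 0) a n * q ^ n.  The pointwise product that
   MathComp puts on functions is not the product of series, hence the
   separate scope for the Cauchy product. *)
Definition fps := nat -> int.

Declare Scope fps_scope.
Delimit Scope fps_scope with fps.
Bind Scope fps_scope with fps.

Definition fps_one : fps := fun n => (n == 0%N)%:R.

Definition fps_mul (a b : fps) : fps :=
  fun n => \sum_(i < n.+1) a i * b (n - i)%N.

Definition fps_exp (a : fps) (m : nat) : fps := iter m (fps_mul a) fps_one.

(* The first n coefficients of the multiplicative inverse of [a], from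
   b_0 = a_0^-1 and b_m = - a_0^-1 * \sum_(1 <= k <= m) a_k b_(m - k);
   meaningful when a_0 is a unit of int, see [fps_mulV]. *)
Fixpoint fps_inv_seq (a : fps) (n : nat) : seq int :=
  if n is m.+1 then
    let s := fps_inv_seq a m in
    rcons s (if m == 0%N then (a 0%N)^-1
             else - (a 0%N)^-1 * \sum_(1 <= k < m.+1) a k * s`_(m - k))
  else [::].

Definition fps_inv (a : fps) : fps := fun n => (fps_inv_seq a n.+1)`_n.

Definition fps_div (a b : fps) : fps := fps_mul a (fps_inv b).

Notation "a * b" := (fps_mul a b) : fps_scope.
Notation "a ^+ m" := (fps_exp a m) : fps_scope.
Notation "a / b" := (fps_div a b) : fps_scope.

(* f_j = (q^j; q^j)_oo = \prod_(k >= 1) (1 - q^(jk)), for j >= 1.  The factors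
   with k > n do not affect the coefficient of q^n, see [eulerf_stable]. *)
Definition eulerf_trunc (j N : nat) : {poly int} :=
  \prod_(1 <= k < N.+1) (1 - 'X^(j * k)).

Definition eulerf (j : nat) : fps := fun n => (eulerf_trunc j n)`_n.

Notation "''f_' j" := (eulerf j)
  (at level 8, j at level 2, format "''f_' j") : fps_scope.

(* The name encodes the exponent pattern 1^-1 2^3 4^-1 5^-2. *)
Definition a_1m1_2p3_4m1_5m2 : fps :=
  ('f_2 ^+ 3 / ('f_1 * 'f_4 * 'f_5 ^+ 2))%fps.

Lemma eulerf_stable (j n N : nat) :
  (0 < j)%N -> (n <= N)%N -> (eulerf_trunc j N)`_n = eulerf j n.
Proof.
move=> j_gt0; elim: N => [|N IHN]; first by rewrite leqn0 => /eqP->.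
rewrite leq_eqVlt => /predU1P[-> // | ltnN].
rewrite /eulerf_trunc big_nat_recr //= mulrBr mulr1 coefB coefMXn.
by rewrite (leq_trans ltnN (leq_pmull _ j_gt0)) subr0 IHN.
Qed.

Lemma eulerf0 (j : nat) : eulerf j 0 = 1.
Proof. by rewrite /eulerf /eulerf_trunc big_geq // coef1. Qed.

Lemma size_fps_inv_seq a n : size (fps_inv_seq a n) = n.
Proof. by elim: n => //= n IHn; rewrite size_rcons IHn. Qed.

Lemma nth_fps_inv_seq a n m :
  (m < n)%N -> (fps_inv_seq a n)`_m = fps_inv a m.
Proof.
elim: n => // n IHn; rewrite ltnS leq_eqVlt => /predU1P[-> // | ltmn].
by rewrite /= nth_rcons size_fps_inv_seq ltmn IHn.
Qed.

Lemma fps_invE a n : fps_inv a n =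
  if n == 0%N then (a 0%N)^-1
  else - (a 0%N)^-1 * \sum_(1 <= k < n.+1) a k * fps_inv a (n - k)%N.
Proof.
rewrite {1}/fps_inv /= nth_rcons size_fps_inv_seq ltnn eqxx.
case: ifP => // n_neq0; congr (_ * _).
rewrite big_nat_cond [RHS]big_nat_cond; apply: eq_bigr => k.
rewrite andbT => /andP[k_gt0 le_kn]; rewrite nth_fps_inv_seq //.
by rewrite ltn_subrL k_gt0 (leq_trans k_gt0).
Qed.

Lemma fps_mulV (a : fps) :
  a 0%N \is a GRing.unit -> (a * fps_inv a)%fps =1 fps_one.
Proof.
move=> a0U n; rewrite /fps_mul /fps_one.
rewrite -(big_mkord xpredT (fun i => a i * fps_inv a (n - i)%N)).
rewrite big_ltn // subn0 [in a 0%N * _]fps_invE.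
case: (eqVneq n 0%N) => [-> | _]; first by rewrite big_geq // addr0 mulrV.
by rewrite mulNr mulrN mulrA mulrV // mul1r addNr.
Qed.

(* Main.v *)
(* Replacing q by -q turns f_1 into f_2^3 / (f_1 f_4), so the series is
   f_1(-q) / f_5^2. The pentagonal exponents are 0, 1 or 2 modulo 5; splitting
   Euler's sum accordingly gives
     f_1 = P_0(q^5) - q f_25 - q^2 P_2(q^5),
   where P_0 and P_2 are sums of two theta series each, and the quintuple
   product identity writes P_0 and P_2 as infinite products. After q -> -q and q^5 -> q,
   the three components divided by f_1^2 are products in which each negative
   factor 1 - q^j cancels against one copy of 1 / f_1; the other copy of 1 / f_1
   makes all coefficients positive.
   Power series are represented by polynomials modulo 'X^N, with N arbitrary. *)
Require Import Defs.
From mathcomp Require Import all_boot all_order all_algebra.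
From mathcomp Require Import ring zify.
From Stdlib Require Import Setoid Morphisms.

Set Implicit Arguments.
Unset Strict Implicit.
Unset Printing Implicit Defensive.

Import Order.TTheory GRing.Theory Num.Theory.
Local Open Scope ring_scope.

(** * Gaussian binomials and the finite Jacobi triple product *)

Section Gauss.
Variables (R : comNzRingType) (p : R).

(** Defined by a Pascal rule since [R] has no division; [gbinom_fact] is the quotient formula with
    denominators cleared. *)
Fixpoint gbinom (n k : nat) : R :=
  match n, k with
  | _, 0 => 1
  | 0, _.+1 => 0
  | n'.+1, k'.+1 => gbinom n' k' + p ^+ k * gbinom n' k
  end.

Definition qfact (n : nat) : R := \prod_(k < n) (1 - p ^+ k.+1).

Lemma gbinom0 n : gbinom n 0 = 1.
Proof. by case: n. Qed.

Lemma gbinomS n k :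
  gbinom n.+1 k.+1 = gbinom n k + p ^+ k.+1 * gbinom n k.+1.
Proof. by []. Qed.

Lemma gbinom_small n k : (n < k)%N -> gbinom n k = 0.
Proof.
elim: n k => [|n IHn] [|k] // ltnk.
by rewrite gbinomS !IHn ?mulr0 ?addr0 //; lia.
Qed.

(** The mirror image of [gbinomS]. In the finite triple product, [gbinomS] absorbs a new factor in
    [b] and this rule a new factor in [a]. *)
Lemma gbinom_recr n k : (k <= n)%N ->
  gbinom n.+1 k.+1 = p ^+ (n - k) * gbinom n k + gbinom n k.+1.
Proof.
elim: n k => [|n IHn] k.
  by rewrite leqn0 => /eqP->; rewrite gbinomS !gbinom0 gbinom_small // mulr0 mulr1.
rewrite leq_eqVlt => /predU1P[->|ltkn].
  by rewrite subnn mul1r gbinomS (@gbinom_small n.+1 n.+2) // mulr0.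
rewrite [LHS]gbinomS [in RHS]gbinomS [X in _ + _ * X]IHn //.
case: k ltkn => [|k] ltkn; first by rewrite !gbinom0 !subn0 (exprS p n) expr1; ring.
rewrite [X in X + _ = _]IHn 1?ltnW // [X in _ = _ * X + _]gbinomS subSS.
rewrite (_ : n - k = (n - k.+1).+1)%N; last by lia.
rewrite !exprS; ring.
Qed.

Lemma qfactS n : qfact n.+1 = qfact n * (1 - p ^+ n.+1).
Proof. by rewrite /qfact big_ord_recr. Qed.

(** Induction on [n] and [k], from 1 - p^(n+k+2) = (1 - p^(k+1)) + p^(k+1) (1 - p^(n+1)). *)
Lemma gbinom_fact n k : qfact n * qfact k * gbinom (n + k) k = qfact (n + k).
Proof.
have q0 : qfact 0 = 1 by rewrite /qfact big_ord0.
elim: n k => [|n IHn] k.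
  elim: k => [|k IHk]; first by rewrite q0 gbinom0 !mulr1.
  rewrite !add0n gbinomS (@gbinom_small k k.+1) // mulr0 addr0 q0 mul1r.
  by move: IHk; rewrite !add0n q0 !mul1r !qfactS mulrAC => ->.
elim: k => [|k IHk]; first by rewrite q0 gbinom0 !mulr1 addn0.
rewrite addnS gbinomS mulrDr.
have -> : qfact n.+1 * qfact k.+1 * gbinom (n.+1 + k) k =
          (1 - p ^+ k.+1) * qfact (n.+1 + k).
  rewrite -IHk (qfactS k); ring.
have -> : qfact n.+1 * qfact k.+1 * (p ^+ k.+1 * gbinom (n.+1 + k) k.+1) =
          p ^+ k.+1 * (1 - p ^+ n.+1) * qfact (n.+1 + k).
  rewrite addSnnS -IHn qfactS; ring.
rewrite qfactS -addnS exprD; ring.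
Qed.

End Gauss.

Arguments gbinom {R} p n k : simpl never.

(** The values j (j + 1) / 2 are taken in [nat] so as to serve as exponents; [Negz n] is -(n + 1),
    whence the same binomial in both cases. *)
Definition tri (j : int) : nat :=
  match j with Posz n => 'C(n.+1, 2) | Negz n => 'C(n.+1, 2) end.

Lemma triE j : (2 * tri j)%:Z = j * (j + 1).
Proof.
have H n : (2 * 'C(n.+1, 2))%:Z = n%:Z * (n%:Z + 1).
  by rewrite bin2 /= mul2n halfK oddM /= andNb subn0 PoszM; lia.
case: j => n; rewrite /tri H // NegzE; lia.
Qed.

Section FiniteTriple.
Variables (R : comNzRingType) (a b : R).

(* The general term of Ramanujan's theta function f(a, b). *)
Definition ramterm (j : int) : R := a ^+ tri j * b ^+ tri (j - 1).

(** The ratio of the terms at j + 1 and j is a (ab)^j; the extra power of ab keeps all exponents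
    nonnegative. *)
Lemma ramterm_up (n : nat) (j : int) : j <= n%:Z ->
  a * (a * b) ^+ n * ramterm j = (a * b) ^+ absz (n%:Z - j) * ramterm (j + 1).
Proof.
move=> lejn; rewrite /ramterm addrK !exprMn.
have h1 := triE j; have h2 := triE (j - 1); have h3 := triE (j + 1).
rewrite [LHS](_ : _ = a ^+ (1 + n + tri j) * b ^+ (n + tri (j - 1))); last first.
  by rewrite !exprD expr1; ring.
rewrite [RHS](_ : _ =
  a ^+ (absz (n%:Z - j) + tri (j + 1)) * b ^+ (absz (n%:Z - j) + tri j)); last first.
  by rewrite !exprD; ring.
by congr (_ ^+ _ * _ ^+ _); nia.
Qed.

Lemma ramterm_down (m : nat) (j : int) : - m%:Z <= j ->
  b * (a * b) ^+ m * ramterm j = (a * b) ^+ absz (m%:Z + j) * ramterm (j - 1).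
Proof.
move=> lejn; rewrite /ramterm !exprMn.
have h1 := triE j; have h2 := triE (j - 1); have h3 := triE (j - 1 - 1).
rewrite [LHS](_ : _ = a ^+ (m + tri j) * b ^+ (1 + m + tri (j - 1))); last first.
  by rewrite !exprD expr1; ring.
rewrite [RHS](_ : _ =
  a ^+ (absz (m%:Z + j) + tri (j - 1)) * b ^+ (absz (m%:Z + j) + tri (j - 1 - 1)));
  last by rewrite !exprD; ring.
by congr (_ ^+ _ * _ ^+ _); nia.
Qed.

(** Each new factor 1 + a (ab)^n or 1 + b (ab)^m shifts the summation index by one, by [ramterm_up]
    or [ramterm_down], and a Pascal rule recombines the two sums. *)
Lemma finite_triple_product (n m : nat) :
  (\prod_(k < n) (1 + a * (a * b) ^+ k)) * (\prod_(k < m) (1 + b * (a * b) ^+ k))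
  = \sum_(i < (n + m).+1) gbinom (a * b) (n + m) i * ramterm (i%:Z - m%:Z).
Proof.
set p := a * b.
elim: n => [|n IHn].
  elim: m => [|m IHm].
    by rewrite !big_ord0 big_ord1 /= /ramterm subrr /tri !expr0 !mulr1.
  rewrite !big_ord0 !mul1r add0n in IHm *.
  rewrite big_ord_recr /= {}IHm add0n [in RHS]big_ord_recl /= gbinom0 mul1r.
  under [in RHS]eq_bigr => i _.
    rewrite (_ : (bump 0 i)%:Z - m.+1%:Z = i%:Z - m%:Z); last by rewrite /bump; lia.
    rewrite /bump add1n gbinomS mulrDl; over.
  rewrite big_split /= addrCA mulrDr mulr1; congr (_ + _).
  rewrite [in RHS]big_ord_recr /= gbinom_small // mulr0 mul0r addr0.
  rewrite mulr_suml big_ord_recl /= gbinom0; congr (_ + _).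
    rewrite mul1r mulrC ramterm_down; last by lia.
    rewrite (_ : absz _ = 0%N) ?mul1r; last by lia.
    by congr (ramterm _); lia.
  apply: eq_bigr => i _; rewrite /bump add1n -mulrA [ramterm _ * _]mulrC.
  rewrite ramterm_down; last by lia.
  rewrite (_ : absz _ = i.+1); last by lia.
  rewrite mulrA [gbinom _ _ _ * _]mulrC; congr (_ * ramterm _); lia.
rewrite big_ord_recr /= mulrAC {}IHn addSn [in RHS]big_ord_recl /= gbinom0 mul1r.
under [in RHS]eq_bigr => i _.
  rewrite /bump add1n gbinom_recr; last by rewrite -ltnS.
  rewrite mulrDl; over.
rewrite big_split /= mulrDr mulr1 [LHS]addrC [RHS]addrCA; congr (_ + _).
  rewrite mulr_suml; apply: eq_bigr => i _.
  have lein : i%:Z - m%:Z <= n%:Z by have := ltn_ord i; lia.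
  rewrite -[LHS]mulrA [X in _ * X = _]mulrC (ramterm_up lein).
  rewrite mulrCA mulrA; congr (_ ^+ _ * _ * ramterm _); lia.
rewrite [in RHS]big_ord_recr /= gbinom_small // mul0r addr0.
rewrite [in LHS]big_ord_recl /= gbinom0 mul1r; congr (_ + _).
Qed.

End FiniteTriple.

(** * Polynomials modulo 'X^N and the Jacobi triple product *)

(** The quotient [c] is explicit, so that compatibility with sums, products and composition reduces
    to polynomial identities. *)
Definition eqm (N : nat) (p q : {poly int}) := exists c, p = q + c * 'X^N.

Lemma eqm_refl N p : eqm N p p.
Proof. by exists 0; rewrite mul0r addr0. Qed.
#[global] Hint Resolve eqm_refl : core.

Lemma eq_eqm N p q : p = q -> eqm N p q.
Proof. by move->. Qed.

Lemma eqm_sym N p q : eqm N p q -> eqm N q p.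
Proof. by case=> c ->; exists (- c); rewrite mulNr addrK. Qed.

Lemma eqm_trans N p q r : eqm N p q -> eqm N q r -> eqm N p r.
Proof. by case=> c -> [d ->]; exists (d + c); rewrite mulrDl addrA. Qed.

Lemma eqmD N p q r s : eqm N p q -> eqm N r s -> eqm N (p + r) (q + s).
Proof. by case=> c -> [d ->]; exists (c + d); ring. Qed.

Lemma eqmN N p q : eqm N p q -> eqm N (- p) (- q).
Proof. by case=> c ->; exists (- c); ring. Qed.

Lemma eqmM N p q r s : eqm N p q -> eqm N r s -> eqm N (p * r) (q * s).
Proof.
by case=> c -> [d ->]; exists (c * s + q * d + c * d * 'X^N); ring.
Qed.

#[global] Instance eqm_equiv N : Equivalence (eqm N).
Proof.
split; [exact: eqm_refl|exact: eqm_sym|exact: eqm_trans].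
Qed.

#[global] Instance eqmD_proper N :
  Proper (eqm N ==> eqm N ==> eqm N) (@GRing.add {poly int}).
Proof. by move=> p q ? r s ?; apply: eqmD. Qed.

#[global] Instance eqmN_proper N :
  Proper (eqm N ==> eqm N) (@GRing.opp {poly int}).
Proof. by move=> p q ?; apply: eqmN. Qed.

#[global] Instance eqmM_proper N :
  Proper (eqm N ==> eqm N ==> eqm N) (@GRing.mul {poly int}).
Proof. by move=> p q ? r s ?; apply: eqmM. Qed.

Lemma eqm_coef N p q : eqm N p q <-> forall i, (i < N)%N -> p`_i = q`_i.
Proof.
split=> [[c ->] i ltiN|eq_pq]; first by rewrite coefD coefMXn ltiN addr0.
exists (drop_poly N (p - q)); rewrite -[p in LHS](subrK q) addrC; congr (_ + _).
rewrite -[p - q in LHS](poly_take_drop N) [take_poly _ _](_ : _ = 0) ?add0r //.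
apply/polyP=> i; rewrite coef_take_poly coef0 coefB.
by case: ifP => // /eq_pq ->; rewrite subrr.
Qed.

Lemma eqm_sum (I : Type) N (r : seq I) (F G : I -> {poly int}) :
  (forall i, eqm N (F i) (G i)) ->
  eqm N (\sum_(i <- r) F i) (\sum_(i <- r) G i).
Proof.
move=> FG; apply: (big_ind2 (eqm N)) => //.
by move=> *; apply: eqmD.
Qed.

Lemma eqm_prod (I : Type) N (r : seq I) (F G : I -> {poly int}) :
  (forall i, eqm N (F i) (G i)) ->
  eqm N (\prod_(i <- r) F i) (\prod_(i <- r) G i).
Proof.
move=> FG; apply: (big_ind2 (eqm N)) => //.
by move=> *; apply: eqmM.
Qed.

Lemma eqm_prod1 (I : Type) N (r : seq I) (F : I -> {poly int}) :
  (forall i, eqm N (F i) 1) -> eqm N (\prod_(i <- r) F i) 1.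
Proof.
move=> F1; apply: (big_ind (fun p => eqm N p 1)) => // p q p1 q1.
by rewrite p1 q1 mulr1.
Qed.

(** Since [r] is a multiple of ['X], its power [r ^+ N] is a multiple of ['X^N]. *)
Lemma eqm_comp N (p q r : {poly int}) : r`_0 = 0 ->
  eqm N p q -> eqm N (p \Po r) (q \Po r).
Proof.
move=> r0 [c ->]; rewrite comp_polyD comp_polyM comp_Xn_poly.
have -> : r = drop_poly 1 r * 'X.
  rewrite -[LHS](poly_take_drop 1) [take_poly _ _](_ : _ = 0) ?add0r //.
  by apply/polyP=> i; rewrite coef_take_poly coef0; case: i.
by rewrite exprMn mulrA; eexists.
Qed.

Lemma eqm_Xn N c n : (N <= n)%N -> eqm N (c * 'X^n) 0.
Proof.
by move=> leNn; exists (c * 'X^(n - N)); rewrite add0r -mulrA -exprD subnK.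
Qed.

Lemma eqm_cancel N (u g p q : {poly int}) :
  eqm N (u * g) 1 -> eqm N (u * p) (u * q) -> eqm N p q.
Proof.
move=> ug1 upq; rewrite -[p]mul1r -[q]mul1r -ug1.
by rewrite ![u * g]mulrC -!mulrA upq.
Qed.

Lemma eqm_prod_stable N n m (F : nat -> {poly int}) : (n <= m)%N ->
  (forall k, (n <= k)%N -> eqm N (F k) 1) ->
  eqm N (\prod_(k < m) F k) (\prod_(k < n) F k).
Proof.
move=> lenm F1; rewrite -(subnKC lenm) big_split_ord /= -[X in eqm _ _ X]mulr1.
apply: eqmM => //.
by apply: eqm_prod1 => i; apply: F1; rewrite leq_addr.
Qed.

Lemma eqm_oppr_eq0 N p : eqm N p (- p) -> eqm N p 0.
Proof.
move=> /eqm_coef pN; apply/eqm_coef => i /pN; rewrite coefN coef0.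
by move: p`_i => x; lia.
Qed.

Definition geom (N d : nat) : {poly int} := \sum_(i < N) ('X^d) ^+ i.

Lemma geom_inv N d : (0 < d)%N -> eqm N ((1 - 'X^d) * geom N d) 1.
Proof.
move=> d_gt0; have := subrX1 ('X^d : {poly int}) N; rewrite -/(geom N d).
move=> E; exists (- 'X^(d * N - N)); rewrite mulNr -exprD subnK ?leq_pmull //.
rewrite exprM -[1 - _]opprB mulNr -E; ring.
Qed.

(** The first [n] factors of f_d; for d > 0 they determine f_d modulo ['X^N] once N <= n. *)
Definition euler (d n : nat) : {poly int} := \prod_(k < n) (1 - 'X^(d * k.+1)).

Lemma euler_inv N d n : (0 < d)%N ->
  eqm N (euler d n * \prod_(k < n) geom N (d * k.+1)) 1.
Proof.
move=> d_gt0; rewrite -big_split /=.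
by apply: eqm_prod1 => k; apply: geom_inv; rewrite muln_gt0 d_gt0.
Qed.

Lemma eqm_fact1 N d : (N <= d)%N -> eqm N (1 - 'X^d) 1.
Proof.
by move=> leNd; exists (- 'X^(d - N)); rewrite mulNr -exprD subnK.
Qed.

Lemma euler_stable N d n m : (0 < d)%N -> (N <= n)%N -> (N <= m)%N ->
  eqm N (euler d n) (euler d m).
Proof.
move=> d_gt0 Nn Nm.
have H k : (N <= k)%N -> eqm N (euler d k) (euler d N).
  move=> Nk; apply: (@eqm_prod_stable N N k (fun i => 1 - 'X^(d * i.+1))) => //.
  by move=> i Ni; apply: eqm_fact1; nia.
by rewrite H // H.
Qed.

(* [F] is, modulo [X^N], supported on the elements of [r], so that summing over
   [r] gives the formal sum of [F] over all of [T]. *)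
Definition carries (T : eqType) N (F : T -> {poly int}) (r : seq T) :=
  uniq r /\ forall x, x \notin r -> eqm N (F x) 0.

(** Both sums reduce to the elements common to [r1] and [r2]. *)
Lemma carries_sum (T : eqType) N (F : T -> {poly int}) r1 r2 :
  carries N F r1 -> carries N F r2 ->
  eqm N (\sum_(x <- r1) F x) (\sum_(x <- r2) F x).
Proof.
suff H r r' : carries N F r -> carries N F r' ->
    eqm N (\sum_(x <- r) F x) (\sum_(x <- r | x \in r') F x).
  move=> c1 c2; rewrite (H _ _ c1 c2) (H _ _ c2 c1).
  rewrite -(big_filter r1) -(big_filter r2).
  rewrite (perm_big [seq x <- r2 | x \in r1]) //.
  case: c1 c2 => [u1 _] [u2 _].
  apply: uniq_perm; rewrite ?filter_uniq // => x.
  by rewrite !mem_filter andbC.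
move=> _ [_ F0]; rewrite (bigID [in r']) /= -[X in eqm _ _ X]addr0.
apply: eqmD => //.
apply: (big_ind (fun p => eqm N p 0)) => //.
by move=> p q p0 q0; rewrite p0 q0 addr0.
Qed.

(** Formal reindexing along [d] classes, [h c] parametrising class [c]. It serves both the lattice
    splitting behind the quintuple product and the 5-dissection. *)
Lemma carries_split (T U : eqType) N (F : T -> {poly int}) (h : nat -> U -> T)
    d (r : seq T) (r' : seq U) :
  carries N F r -> uniq r' ->
  (forall c c' x x', (c < d)%N -> (c' < d)%N -> h c x = h c' x' ->
     c = c' /\ x = x') ->
  (forall t, (exists c x, [/\ (c < d)%N, x \in r' & t = h c x]) \/
     eqm N (F t) 0) ->
  eqm N (\sum_(t <- r) F t) (\sum_(c < d) \sum_(x <- r') F (h c x)).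
Proof.
move=> cr ur' inj_h cov.
rewrite -(big_mkord predT (fun c => \sum_(x <- r') F (h c x))) /index_iota subn0.
rewrite -(@big_allpairs_dep _ _ _ _ _ _ h (iota 0 d) (fun _ => r') F).
apply: carries_sum => //; split.
  apply: allpairs_uniq_dep => //; first exact: iota_uniq.
  move=> [c x] [c' x'] /allpairsPdep[k [y [kd yr [-> ->]]]].
  move=> /allpairsPdep[k' [y' [kd' yr' [-> ->]]]] /=.
  by move: kd kd'; rewrite !mem_iota => kd kd' /inj_h[]// -> ->.
move=> t; case: (cov t) => [[c [x [cd xr' ->]]]|//].
by case/negP; apply/allpairsPdep; exists c, x; rewrite mem_iota.
Qed.

Definition zrange (N : nat) : seq int :=
  [seq i%:Z - N%:Z | i <- iota 0 (N + N).+1].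

Lemma mem_zrange N x : (x \in zrange N) = (absz x <= N)%N.
Proof.
apply/mapP/idP => [[i]|leN]; first by rewrite mem_iota => ? ->; lia.
by exists (absz (x + N%:Z)); rewrite ?mem_iota; lia.
Qed.

Lemma zrange_uniq N : uniq (zrange N).
Proof. by rewrite map_inj_uniq ?iota_uniq // => i j; lia. Qed.

Section JacobiTriple.
Variables (u : {poly int}) (al be : nat).
Hypothesis uu : u * u = 1.

(** With [u] equal to 1 or -1, the general term of f(u q^al, u q^be). *)
Definition theta (j : int) : {poly int} := ramterm (u * 'X^al) (u * 'X^be) j.

(** The sum [tri j + tri (j - 1)] is j^2, which has the parity of j, so the sign is u^j. *)
Lemma thetaE j : theta j =
  u ^+ absz j * 'X^(al * tri j + be * tri (j - 1)).
Proof.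
rewrite /theta /ramterm !exprMn -!exprM mulrACA -!exprD; congr (_ * _).
have h1 := triE j; have h2 := triE (j - 1).
have -> : (tri j + tri (j - 1) = absz j * absz j)%N by nia.
have [k ->] : exists k, (absz j * absz j = absz j + 2 * k)%N.
  exists 'C(absz j, 2); rewrite mul2n bin2 halfK oddM; case: (absz j) => [|n] //=.
  rewrite andNb subn0; nia.
by rewrite exprD exprM expr2 uu expr1n mulr1.
Qed.

Hypotheses (al_gt0 : (0 < al)%N) (be_gt0 : (0 < be)%N).

Lemma theta_small N j : (N <= absz j)%N -> eqm N (theta j) 0.
Proof.
move=> leNj; rewrite thetaE; apply: eqm_Xn.
have h1 := triE j; have h2 := triE (j - 1).
(* With [al] and [be] positive, the exponent is at least j^2 >= |j|. *)
have H : (absz j <= tri j + tri (j - 1))%N by nia.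
nia.
Qed.

Lemma carries_theta N M : (N <= M)%N -> carries N theta (zrange M).
Proof.
move=> leNM; split; first exact: zrange_uniq.
by move=> j; rewrite mem_zrange => jM; apply: theta_small; lia.
Qed.

(** Taking [n] factors on each side of the finite identity and multiplying by the Euler product
    removes the Gaussian binomials modulo ['X^N]. *)
Lemma jacobi_triple N n : (N + N <= n)%N ->
  eqm N (\prod_(k < n) ((1 + u * 'X^(al + (al + be) * k)) *
     (1 + u * 'X^(be + (al + be) * k)) * (1 - 'X^((al + be) * k.+1))))
   (\sum_(j <- zrange N) theta j).
Proof.
move=> leNn; set a := u * 'X^al; set b := u * 'X^be.
have ab : a * b = 'X^(al + be) by rewrite mulrACA uu mul1r exprD.
have d_gt0 : (0 < al + be)%N by rewrite addn_gt0 al_gt0.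
rewrite !big_split /= -/(euler (al + be) n).
rewrite [X in eqm _ (X * _)](_ : _ =
  \sum_(i < (n + n).+1) gbinom (a * b) (n + n) i * ramterm a b (i%:Z - n%:Z));
  last first.
  rewrite -finite_triple_product; congr (_ * _); apply: eq_bigr => i _;
  by rewrite ab -exprM exprD mulrA.
rewrite mulr_suml.
have E k : qfact (a * b) k = euler (al + be) k.
  by rewrite ab; apply: eq_bigr => i _; rewrite exprM.
transitivity (\sum_(i < (n + n).+1) theta (i%:Z - n%:Z)).
  apply: eqm_sum => i; rewrite mulrAC -/(theta _).
  have [leN|gtN] := leqP N (absz (i%:Z - n%:Z)).
    by rewrite (theta_small leN) mulr0.
  rewrite -[X in eqm _ _ X]mul1r; apply: eqmM => //.
  apply: (eqm_cancel (euler_inv N n d_gt0)).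
  (* For |i - n| < N both i and n + n - i are at least N, as N + N <= n. All Euler products in
     [gbinom_fact] are then congruent to [euler (al + be) n]. *)
  have := gbinom_fact (a * b) (n + n - i) i; rewrite subnK; last by rewrite -ltnS.
  rewrite !E mulr1 => Ei.
  have S m : (N <= m)%N -> eqm N (euler (al + be) m) (euler (al + be) n).
    by move=> Nm; apply: euler_stable => //; lia.
  have := eqm_refl N (euler (al + be) (n + n)); rewrite -{1}Ei.
  rewrite !S; try lia.
  by rewrite -mulrA [X in _ * X]mulrC.
have -> : \sum_(i < (n + n).+1) theta (i%:Z - n%:Z) = \sum_(j <- zrange n) theta j.
  by rewrite big_map -(big_mkord predT (fun i => theta (i%:Z - n%:Z))) /index_iota subn0.
by apply: carries_sum; apply: carries_theta => //; lia.
Qed.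

End JacobiTriple.

(** * The quintuple product identity *)

Lemma prod_blocks (R : comNzRingType) d n (F : nat -> R) :
  \prod_(k < d * n) F k = \prod_(k < n) \prod_(i < d) F (d * k + i)%N.
Proof.
elim: n => [|n IHn]; first by rewrite muln0 !big_ord0.
by rewrite big_ord_recr -IHn mulnS addnC big_split_ord.
Qed.

Definition thsum (N : nat) (u : {poly int}) (al be : nat) : {poly int} :=
  \sum_(j <- zrange N) theta u al be j.

Lemma mulN1N1 : (-1 : {poly int}) * -1 = 1.
Proof. by rewrite mulrNN mulr1. Qed.

(** Euler's pentagonal number theorem: in the triple product at (d, 2d), each block consists of
    three consecutive factors of f_d. *)
Lemma euler_thsum N n d : (0 < d)%N -> (N <= n)%N ->
  eqm N (euler d n) (thsum N (-1) d (2 * d)).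
Proof.
move=> d_gt0 leNn; have d2_gt0 : (0 < 2 * d)%N by rewrite muln_gt0.
rewrite /thsum -(jacobi_triple mulN1N1 d_gt0 d2_gt0 (leqnn (N + N))).
rewrite (@euler_stable N d n (3 * (N + N))) //; last by lia.
rewrite /euler (prod_blocks 3 (N + N) (fun k => 1 - 'X^(d * k.+1) : {poly int})).
apply: eqm_prod => k; rewrite !big_ord_recl big_ord0 mulr1 mulrA /bump /= !mulN1r.
have -> : (d * (3 * k + 0).+1 = d + (d + 2 * d) * k)%N by nia.
have -> : (d * (3 * k + (1 + 0)).+1 = 2 * d + (d + 2 * d) * k)%N by nia.
by have -> : (d * (3 * k + (1 + (1 + 0))).+1 = (d + 2 * d) * k.+1)%N by nia.
Qed.

(** The same series in the order f(-q^(2d), -q^d), which occurs in class 1 of the quintuple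
    splitting and in the 5-dissection. *)
Lemma euler_thsumC N n d : (0 < d)%N -> (N <= n)%N ->
  eqm N (euler d n) (thsum N (-1) (2 * d) d).
Proof.
move=> d_gt0 leNn; have d2_gt0 : (0 < 2 * d)%N by rewrite muln_gt0.
rewrite (euler_thsum d_gt0 leNn) /thsum.
rewrite -(jacobi_triple mulN1N1 d_gt0 d2_gt0 (leqnn (N + N))).
rewrite -(jacobi_triple mulN1N1 d2_gt0 d_gt0 (leqnn (N + N))).
apply: eqm_prod => k; rewrite [(2 * d + d)%N]addnC.
by rewrite [X in X * _]mulrC.
Qed.

Section Quintuple.
Variables (N : nat) (A B L0 L1 M0 M1 : int -> {poly int}) (s : bool).

(** For (i, j) = [h c (l, m)], the sum i + j is 3 l, 3 l + 1 or 3 l - 1 for c = 0, 1, 2. The flag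
    [s] chooses between two parametrisations of class 1, exchanged by m -> 1 - m, to suit the theta
    terms wanted in m. *)
Let h (c : nat) (x : int * int) : int * int :=
  match c with
  | 0 => (2 * x.1 - x.2, x.1 + x.2)
  | 1 => if s then (2 * x.1 - x.2 + 1, x.1 + x.2)
         else (2 * x.1 + x.2, x.1 - x.2 + 1)
  | _ => (2 * x.1 - x.2 - 1, x.1 + x.2)
  end.

Hypothesis A_small : forall i, (N <= absz i)%N -> eqm N (A i) 0.
Hypothesis B_small : forall i, (N <= absz i)%N -> eqm N (B i) 0.

Let F (x : int * int) := A x.1 * B x.2.

Hypothesis F0 : forall l m, F (h 0 (l, m)) = L0 l * M0 m.
Hypothesis F1 : forall l m, F (h 1 (l, m)) = L1 l * M1 m.
Hypothesis F2 : forall l m, F (h 2 (1 - l, m)) = - F (h 2 (l, m)).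

Let F_small x : (N <= maxn (absz x.1) (absz x.2))%N -> eqm N (F x) 0.
Proof.
rewrite leq_max /F => /orP[/A_small|/B_small] ->; first by rewrite mul0r.
by rewrite mulr0.
Qed.

Let box := [seq (l, m) | l <- zrange N, m <- zrange N].

Let box_uniq : uniq box.
Proof. by apply: allpairs_uniq => [||[? ?] [? ?]] //; apply: zrange_uniq. Qed.

Let mem_box x : (x \in box) = (absz x.1 <= N)%N && (absz x.2 <= N)%N.
Proof.
case: x => l m; apply/allpairsP/idP => [[[l' m'] /= []]|/andP[lN mN]].
  by rewrite !mem_zrange => lN mN [-> ->]; rewrite lN.
by exists (l, m); rewrite !mem_zrange.
Qed.

Let sum_h2 : eqm N (\sum_(x <- box) F (h 2 x)) 0.
Proof.
pose g (x : int * int) : int * int := (1 - x.1, x.2).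
have gK : involutive g by case=> l m; congr (_, _) => /=; ring.
have Fg x : F (h 2 (g x)) = - F (h 2 x) by case: x => l m; apply: F2.
have small x : x \notin box -> eqm N (F (h 2 x)) 0.
  by rewrite mem_box; case: x => l m /= xN; apply: F_small => /=; lia.
have c1 : carries N (fun x => F (h 2 x)) box by [].
(* The box is not stable under [g]; its image is a second finite support of the same formal sum. *)
have c2 : carries N (fun x => F (h 2 x)) (map g box).
  split=> [|x xN]; first by rewrite map_inj_uniq //; apply: inv_inj.
  rewrite -[x]gK Fg small ?oppr0 //; apply: contra xN => xN.
  by rewrite -[x]gK map_f.
apply: eqm_oppr_eq0; apply: eqm_trans (carries_sum c1 c2) _.
by rewrite big_map -sumrN; under eq_bigr do rewrite Fg.
Qed.

(* The lattice of pairs (i, j) splits according to i + j mod 3. The class of 2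
   cancels under l -> 1 - l, the others factor as sums over l and m. *)
Lemma quintuple_split :
  eqm N ((\sum_(i <- zrange N) A i) * (\sum_(j <- zrange N) B j))
        ((\sum_(l <- zrange N) L0 l) * (\sum_(m <- zrange N) M0 m) +
         (\sum_(l <- zrange N) L1 l) * (\sum_(m <- zrange N) M1 m)).
Proof.
have box_sum (f g : int -> {poly int}) :
    (\sum_(i <- zrange N) f i) * (\sum_(j <- zrange N) g j) =
    \sum_(x <- box) f x.1 * g x.2.
  by rewrite big_distrlr /= -(big_allpairs (F := fun x => f x.1 * g x.2)).
have carF : carries N F box.
  by split=> //; case=> i j; rewrite mem_box /= => ijN; apply: F_small => /=; lia.
rewrite box_sum; apply: eqm_trans (carries_split (h := h) (d := 3) carF box_uniq _ _) _.
- move=> [|[|[|?]]] [|[|[|?]]] [l m] [l' m'] //= _ _; case: s => -[eq1 eq2];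
  by split=> //; (try congr (_, _)); lia.
- move=> [i j]; have [leN|ltN] := leqP N (maxn (absz i) (absz j)).
    by right; apply: F_small.
  left.
  have : exists l, i + j = 3 * l \/ i + j = 3 * l + 1 \/ i + j = 3 * l - 1.
    (* This is (i + j) / 3 rounded to the nearest integer. *)
    exists ((i + j + 1) %/ 3)%Z; lia.
  case=> l [E|[E|E]].
  + by exists 0%N, (l, j - l); split=> //=; [rewrite mem_box /=; lia|congr (_, _); lia].
  + exists 1%N; rewrite /h; case: s.
      by exists (l, j - l); split=> //=; [rewrite mem_box /=; lia|congr (_, _); lia].
    by exists (l, l + 1 - j); split=> //=; [rewrite mem_box /=; lia|congr (_, _); lia].
  + by exists 2%N, (l, j - l); split=> //=; [rewrite mem_box /=; lia|congr (_, _); lia].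
rewrite !big_ord_recl big_ord0 addr0 /= sum_h2 addr0 !box_sum.
apply: eqmD; apply: eq_eqm; apply: eq_bigr => -[l m] _; first exact: F0.
exact: F1.
Qed.

End Quintuple.

Lemma signX_eq a b c d : odd a = odd b -> c = d ->
  (-1) ^+ a * 'X^c = (-1) ^+ b * 'X^d :> {poly int}.
Proof. by move=> ab ->; rewrite -signr_odd ab signr_odd. Qed.

Definition theta_exp (al be : nat) (j : int) := (al * tri j + be * tri (j - 1))%N.

Lemma theta_expE al be j :
  (theta_exp al be j)%:Z * 2 = al%:Z * (j * (j + 1)) + be%:Z * (j * (j - 1)).
Proof.
have h1 := triE j; have h2 := triE (j - 1).
have -> : j * (j - 1) = (2 * tri (j - 1))%N by lia.
rewrite -h1 /theta_exp; lia.
Qed.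

(** Doubling removes the halves in [tri]: an equality of exponents becomes a polynomial identity
    over the integers. *)
Lemma theta_exp_add (c al1 be1 al2 be2 al3 be3 al4 be4 : nat) (i j l m : int) :
  al1%:Z * (i * (i + 1)) + be1%:Z * (i * (i - 1)) +
  (al2%:Z * (j * (j + 1)) + be2%:Z * (j * (j - 1))) =
  al3%:Z * (l * (l + 1)) + be3%:Z * (l * (l - 1)) +
  (c%:Z * 2 + (al4%:Z * (m * (m + 1)) + be4%:Z * (m * (m - 1)))) ->
  (theta_exp al1 be1 i + theta_exp al2 be2 j =
   theta_exp al3 be3 l + (c + theta_exp al4 be4 m))%N.
Proof. rewrite -!theta_expE; lia. Qed.

Lemma theta1E al be j :
  theta 1 al be j = 'X^(theta_exp al be j).
Proof.
rewrite (thetaE _ _ (mulr1 1)) -[RHS]mul1r; congr (_ * _); exact: expr1n.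
Qed.

Lemma thetaN1E al be j : theta (-1) al be j =
  (-1) ^+ absz j * 'X^(theta_exp al be j).
Proof. exact: thetaE mulN1N1 _. Qed.

Lemma theta1_thetaN1 al1 be1 al2 be2 i j :
  theta 1 al1 be1 i * theta (-1) al2 be2 j =
  (-1) ^+ absz j * 'X^(theta_exp al1 be1 i + theta_exp al2 be2 j).
Proof. by rewrite theta1E thetaN1E mulrCA -exprD. Qed.

Lemma theta_comp d al be j :
  theta (-1) al be j \Po 'X^d = theta (-1) (d * al) (d * be) j.
Proof.
rewrite !thetaN1E !rmorphM !rmorphXn /= rmorphN1 comp_polyX.
by rewrite -exprM /theta_exp mulnDr !mulnA.
Qed.

Lemma thsum_comp N d al be :
  thsum N (-1) al be \Po 'X^d = thsum N (-1) (d * al) (d * be).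
Proof. by rewrite /thsum rmorph_sum; apply: eq_bigr => j _; apply: theta_comp. Qed.

(** * Two instances of the quintuple product identity *)

Section Specialisations.

(** Under i = 2 l - m, j = l + m the doubled quadratic part 5 i^2 + 10 j^2 becomes 30 l^2 + 15 m^2:
    there is no cross term, so the product separates. *)
Let quintuple14_0 (l m : int) :
  theta 1 1 4 (2 * l - m) * theta (-1) 3 7 (l + m) =
  theta (-1) 10 20 l * theta (-1) 7 8 m.
Proof.
rewrite theta1_thetaN1 !thetaN1E mulrACA -!exprD.
apply: signX_eq; first by lia.
by apply: (@theta_exp_add 0); lia.
Qed.

Let quintuple14_1 (l m : int) :
  theta 1 1 4 (2 * l - m + 1) * theta (-1) 3 7 (l + m) =
  theta (-1) 20 10 l * ('X * theta (-1) 2 13 m).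
Proof.
rewrite theta1_thetaN1 !thetaN1E ['X * _]mulrCA -exprS mulrACA -!exprD.
apply: signX_eq; first by lia.
by apply: (@theta_exp_add 1); lia.
Qed.

Let quintuple14_2 (l m : int) :
  theta 1 1 4 (2 * (1 - l) - m - 1) * theta (-1) 3 7 (1 - l + m) =
  - (theta 1 1 4 (2 * l - m - 1) * theta (-1) 3 7 (l + m)).
Proof.
rewrite !theta1_thetaN1 -[RHS]mulN1r mulrA -exprS.
apply: signX_eq; first by lia.
by apply: (@theta_exp_add 0); lia.
Qed.

(** In both surviving classes the sum over l is f_10, by the pentagonal number theorem; the
    remaining bracket is P_0. *)
Lemma quintuple_14 N n : (N <= n)%N ->
  eqm N (thsum N 1 1 4 * thsum N (-1) 3 7)
        (euler 10 n * (thsum N (-1) 7 8 + 'X * thsum N (-1) 2 13)).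
Proof.
move=> leNn; rewrite mulrDr {1}(@euler_thsum N n 10) // (@euler_thsumC N n 10) //.
rewrite [X in eqm _ _ (_ + _ * X)]mulr_sumr.
apply: (@quintuple_split N _ _ _ _ _ _ true).
- by move=> i; apply: theta_small; rewrite ?mulr1.
- by move=> i; apply: theta_small; rewrite ?mulN1N1.
- exact: quintuple14_0.
- exact: quintuple14_1.
- exact: quintuple14_2.
Qed.

Let quintuple23_0 (l m : int) :
  theta 1 2 3 (2 * l - m) * theta (-1) 1 9 (l + m) =
  theta (-1) 10 20 l * theta (-1) 4 11 m.
Proof.
rewrite theta1_thetaN1 !thetaN1E mulrACA -!exprD.
apply: signX_eq; first by lia.
by apply: (@theta_exp_add 0); lia.
Qed.

Let quintuple23_1 (l m : int) :
  theta 1 2 3 (2 * l + m) * theta (-1) 1 9 (l - m + 1) =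
  theta (-1) 20 10 l * (- 'X * theta (-1) 1 14 m).
Proof.
rewrite theta1_thetaN1 !thetaN1E mulNr mulrN -[RHS]mulN1r.
rewrite ['X * _]mulrCA -exprS mulrACA -!exprD mulrA -exprS.
apply: signX_eq; first by lia.
by apply: (@theta_exp_add 1); lia.
Qed.

Let quintuple23_2 (l m : int) :
  theta 1 2 3 (2 * (1 - l) - m - 1) * theta (-1) 1 9 (1 - l + m) =
  - (theta 1 2 3 (2 * l - m - 1) * theta (-1) 1 9 (l + m)).
Proof.
rewrite !theta1_thetaN1 -[RHS]mulN1r mulrA -exprS.
apply: signX_eq; first by lia.
by apply: (@theta_exp_add 0); lia.
Qed.

(** The companion identity for P_2, with the other parametrisation of class 1. *)
Lemma quintuple_23 N n : (N <= n)%N ->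
  eqm N (thsum N 1 2 3 * thsum N (-1) 1 9)
        (euler 10 n * (thsum N (-1) 4 11 - 'X * thsum N (-1) 1 14)).
Proof.
move=> leNn; rewrite -mulNr mulrDr {1}(@euler_thsum N n 10) // (@euler_thsumC N n 10) //.
rewrite [X in eqm _ _ (_ + _ * X)]mulr_sumr.
apply: (@quintuple_split N _ _ _ _ _ _ false).
- by move=> i; apply: theta_small; rewrite ?mulr1.
- by move=> i; apply: theta_small; rewrite ?mulN1N1.
- exact: quintuple23_0.
- exact: quintuple23_1.
- exact: quintuple23_2.
Qed.

End Specialisations.

(** * The 5-dissection of f_1 *)

Lemma theta_shift (s : bool) c al1 be1 al2 be2 (i j : int) :
  odd (absz i) = s (+) odd (absz j) ->
  al1%:Z * (i * (i + 1)) + be1%:Z * (i * (i - 1)) =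
  c%:Z * 2 + (al2%:Z * (j * (j + 1)) + be2%:Z * (j * (j - 1))) ->
  theta (-1) al1 be1 i = (-1) ^+ s * ('X^c * theta (-1) al2 be2 j).
Proof.
move=> par ex; rewrite !thetaN1E ['X^c * _]mulrCA -exprD mulrA -exprD.
apply: signX_eq; first by rewrite oddD par oddb.
by move: ex; rewrite -!theta_expE; lia.
Qed.

Lemma thsum_1_2_split N :
  eqm N (thsum N (-1) 1 2)
   ((thsum N (-1) 7 8 + 'X * thsum N (-1) 2 13) \Po 'X^5
    - 'X * thsum N (-1) 50 25
    - 'X^2 * ((thsum N (-1) 4 11 - 'X * thsum N (-1) 1 14) \Po 'X^5)).
Proof.
(* Modulo 5, the exponent j (3 j - 1) / 2 is 0 for j = 0, 2, is 1 for j = 1 and 2 for j = 3, 4. Up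
   to sign, the first two classes make up P_0, the third q f_25 and the last two q^2 P_2. *)
pose h (c : nat) (m : int) : int :=
  match c with
  | 0 => 5 * m | 1 => 2 - 5 * m | 2 => 5 * m + 1 | 3 => 5 * m - 2
  | _ => 5 * m - 1
  end.
have car : carries N (theta (-1) 1 2) (zrange N).
  by apply: carries_theta => //; apply: mulN1N1.
apply: eqm_trans (carries_split (h := h) (d := 5) car (zrange_uniq N) _ _) _.
- by move=> [|[|[|[|[|?]]]]] [|[|[|[|[|?]]]]] x x' //=; lia.
- move=> j; have [leN|ltN] := leqP N (absz j).
    by right; apply: theta_small => //; apply: mulN1N1.
  left; have : exists m, [\/ j = 5 * m \/ j = 2 - 5 * m, j = 5 * m + 1,
      j = 5 * m - 2 | j = 5 * m - 1].
    have := modz_ge0 j (isT : 5%:Z != 0); have := ltz_pmod j (isT : 0 < 5%:Z).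
    have := divz_eq j 5; set m := (j %/ 5)%Z; set r := (j %% 5)%Z => jE r_lt r_ge.
    have [E|[E|[E|[E|E]]]] : r = 0 \/ r = 1 \/ r = 2 \/ r = 3 \/ r = 4 by lia.
    + by exists m; constructor 1; left; lia.
    + by exists m; constructor 2; lia.
    + by exists (- m); constructor 1; right; lia.
    + by exists (m + 1); constructor 3; lia.
    + by exists (m + 1); constructor 4; lia.
  case=> m [[|]|||] E.
  + by exists 0%N, m; rewrite mem_zrange; split => //; lia.
  + by exists 1%N, m; rewrite mem_zrange; split => //; lia.
  + by exists 2%N, m; rewrite mem_zrange; split => //; lia.
  + by exists 3%N, m; rewrite mem_zrange; split => //; lia.
  + by exists 4%N, m; rewrite mem_zrange; split => //; lia.
rewrite !big_ord_recl big_ord0 addr0 /=.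
have S s c al be (g : int -> int) :
    (forall m, theta (-1) 1 2 (g m) =
       (-1) ^+ nat_of_bool s * ('X^c * theta (-1) al be m)) ->
    \sum_(m <- zrange N) theta (-1) 1 2 (g m) =
    (-1) ^+ s * ('X^c * thsum N (-1) al be).
  by move=> E; rewrite /thsum !mulr_sumr; apply: eq_bigr => m _; apply: E.
rewrite (S false 0%N 35 40); last by move=> m; apply: theta_shift; lia.
rewrite (S false 5 10 65); last by move=> m; apply: theta_shift; lia.
rewrite (S true 1%N 50 25); last by move=> m; apply: theta_shift; lia.
rewrite (S false 7 5 70); last by move=> m; apply: theta_shift; lia.
rewrite (S true 2 20 55); last by move=> m; apply: theta_shift; lia.
rewrite !rmorphB !rmorphD !rmorphM /= comp_polyX !thsum_comp.
apply: eq_eqm.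
rewrite (_ : 'X^7 = 'X^2 * 'X^5 :> {poly int}); last by rewrite -exprD.
rewrite !expr0 expr1; ring.
Qed.

(* Q0 and Q2 evaluated at q are the truncated products of P_0(q) and P_2(q). *)
Definition Q0 (n : nat) (y : {poly int}) : {poly int} :=
  \prod_(k < n) ((1 + y ^+ (5 * k + 1)) * (1 + y ^+ (5 * k + 4)) *
    (1 - y ^+ (5 * k + 5)) * (1 - y ^+ (10 * k + 3)) * (1 - y ^+ (10 * k + 7))).

Definition Q2 (n : nat) (y : {poly int}) : {poly int} :=
  \prod_(k < n) ((1 + y ^+ (5 * k + 2)) * (1 + y ^+ (5 * k + 3)) *
    (1 - y ^+ (5 * k + 5)) * (1 - y ^+ (10 * k + 1)) * (1 - y ^+ (10 * k + 9))).

Lemma Q0_comp n y z : Q0 n y \Po z = Q0 n (y \Po z).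
Proof.
rewrite /Q0 rmorph_prod; apply: eq_bigr => k _.
by rewrite !rmorphM !rmorphB !rmorphD !rmorph1 !rmorphXn.
Qed.

Lemma Q2_comp n y z : Q2 n y \Po z = Q2 n (y \Po z).
Proof.
rewrite /Q2 rmorph_prod; apply: eq_bigr => k _.
by rewrite !rmorphM !rmorphB !rmorphD !rmorph1 !rmorphXn.
Qed.

(** Multiplied by f_10, both sides become f(q, q^4) f(-q^3, -q^7): the left by the quintuple product
    identity, the right block by block by the triple product. *)
Lemma Q0_thsum N n : (N + N <= n)%N ->
  eqm N (thsum N (-1) 7 8 + 'X * thsum N (-1) 2 13) (Q0 n 'X).
Proof.
move=> leNn; apply: (eqm_cancel (euler_inv N n (isT : 0 < 10)%N)).
rewrite -quintuple_14; last by lia.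
rewrite /thsum -(@jacobi_triple 1 1 4 (mulr1 1) isT isT N n leNn).
rewrite -(@jacobi_triple (-1) 3 7 mulN1N1 isT isT N n leNn); apply: eq_eqm.
rewrite -!big_split; apply: eq_bigr => k _ /=.
rewrite !mulN1r !mul1r !mulnS.
rewrite [(1 + _ * _)%N]addnC [(4 + _ * _)%N]addnC [(3 + _ * _)%N]addnC.
rewrite [(7 + _ * _)%N]addnC [(1 + 4 + _)%N]addnC.
ring.
Qed.

Lemma Q2_thsum N n : (N + N <= n)%N ->
  eqm N (thsum N (-1) 4 11 - 'X * thsum N (-1) 1 14) (Q2 n 'X).
Proof.
move=> leNn; apply: (eqm_cancel (euler_inv N n (isT : 0 < 10)%N)).
rewrite -quintuple_23; last by lia.
rewrite /thsum -(@jacobi_triple 1 2 3 (mulr1 1) isT isT N n leNn).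
rewrite -(@jacobi_triple (-1) 1 9 mulN1N1 isT isT N n leNn); apply: eq_eqm.
rewrite -!big_split; apply: eq_bigr => k _ /=.
rewrite !mulN1r !mul1r !mulnS.
rewrite [(2 + _ * _)%N]addnC [(3 + _ * _)%N]addnC [(1 + _ * _)%N]addnC.
rewrite [(9 + _ * _)%N]addnC [(2 + 3 + _)%N]addnC.
ring.
Qed.

Lemma euler_dissection N n : (N + N <= n)%N ->
  eqm N (euler 1 n) (Q0 n 'X^5 - 'X * euler 25 n - 'X^2 * Q2 n 'X^5).
Proof.
move=> leNn; have leNn' : (N <= n)%N by lia.
rewrite (@euler_thsum N n 1) // thsum_1_2_split (@euler_thsumC N n 25) //.
have X5_0 : ('X^5 : {poly int})`_0 = 0 by rewrite coefXn.
rewrite (eqm_comp X5_0 (Q0_thsum leNn)) (eqm_comp X5_0 (Q2_thsum leNn)).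
by rewrite Q0_comp Q2_comp comp_polyX.
Qed.

(** * Positivity *)

Definition nneg_poly (p : {poly int}) := forall i, 0 <= p`_i.

Lemma nneg_poly1 : nneg_poly 1.
Proof. by move=> i; rewrite coef1 ler0n. Qed.

Lemma nneg_polyD p q : nneg_poly p -> nneg_poly q -> nneg_poly (p + q).
Proof. by move=> p0 q0 i; rewrite coefD addr_ge0. Qed.

Lemma nneg_polyM p q : nneg_poly p -> nneg_poly q -> nneg_poly (p * q).
Proof.
by move=> p0 q0 i; rewrite coefM sumr_ge0 // => j _; rewrite mulr_ge0.
Qed.

Lemma nneg_poly_geom N d : nneg_poly (geom N d).
Proof.
by move=> i; rewrite coef_sum sumr_ge0 // => j _; rewrite -exprM coefXn ler0n.
Qed.

Lemma nneg_poly_1Xn d : nneg_poly (1 + 'X^d).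
Proof. by apply: nneg_polyD nneg_poly1 _ => i; rewrite coefXn ler0n. Qed.

(** For invertible [p], this says that u / p has nonnegative coefficients modulo ['X^N]; the
    denominator comes first. *)
Definition nneg_quot (N : nat) (p u : {poly int}) :=
  exists2 v, nneg_poly v & eqm N (p * v) u.

Lemma nneg_quotM N p q u w :
  nneg_quot N p u -> nneg_quot N q w -> nneg_quot N (p * q) (u * w).
Proof.
move=> [v vP uE] [v' vP' wE]; exists (v * v'); first exact: nneg_polyM.
by rewrite mulrACA; apply: eqmM.
Qed.

Lemma nneg_quot_id N p : nneg_quot N p p.
Proof. by exists 1; rewrite ?mulr1 //; apply: nneg_poly1. Qed.

Lemma nneg_quot_fact N d u :
  (0 < d)%N -> nneg_poly u -> nneg_quot N (1 - 'X^d) u.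
Proof.
move=> d_gt0 uP; exists (geom N d * u).
  exact: nneg_polyM (nneg_poly_geom _ _) _.
by rewrite mulrA geom_inv // mul1r.
Qed.

Lemma nneg_quot_prod (I : Type) N (r : seq I) (p u : I -> {poly int}) :
  (forall k, nneg_quot N (p k) (u k)) ->
  nneg_quot N (\prod_(k <- r) p k) (\prod_(k <- r) u k).
Proof.
move=> pu; apply: (big_ind2 (nneg_quot N)) => //; first exact: nneg_quot_id.
by move=> *; apply: nneg_quotM.
Qed.

Lemma exprNX d : (- 'X) ^+ d = (if odd d then - 'X^d else 'X^d) :> {poly int}.
Proof. by rewrite exprNn -signr_odd; case: odd; rewrite ?expr1 ?mulN1r ?mul1r. Qed.

(** The quotient is 1 for odd [d] and (1 + q^d) / (1 - q^d) for even [d]; in [nneg_quot_1B] the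
    parities are exchanged. *)
Lemma nneg_quot_1D N d : (0 < d)%N ->
  nneg_quot N (1 - 'X^d) (1 + (- 'X) ^+ d).
Proof.
move=> d_gt0; rewrite exprNX; case: odd; first exact: nneg_quot_id.
exact/nneg_quot_fact/nneg_poly_1Xn.
Qed.

Lemma nneg_quot_1B N d : (0 < d)%N ->
  nneg_quot N (1 - 'X^d) (1 - (- 'X) ^+ d).
Proof.
move=> d_gt0; rewrite exprNX; case: odd; last exact: nneg_quot_id.
rewrite opprK; exact/nneg_quot_fact/nneg_poly_1Xn.
Qed.

Lemma nneg_1B_odd d : odd d -> nneg_poly (1 - (- 'X) ^+ d).
Proof. by move=> dO; rewrite exprNX dO opprK; apply: nneg_poly_1Xn. Qed.

(** Five consecutive factors of f_1 are paired with one block of [Q0], [Q1] or [Q2]. *)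
Lemma nneg_quot_block N n (u : 'I_n -> {poly int}) :
  (forall k : 'I_n, nneg_quot N ((1 - 'X^(5 * k + 1)) * (1 - 'X^(5 * k + 2)) *
     (1 - 'X^(5 * k + 3)) * (1 - 'X^(5 * k + 4)) * (1 - 'X^(5 * k + 5))) (u k)) ->
  nneg_quot N (euler 1 (5 * n)) (\prod_(k < n) u k).
Proof.
move=> pu; rewrite /euler (prod_blocks 5 n (fun k => 1 - 'X^(1 * k.+1) : {poly int})).
apply: nneg_quot_prod => k.
have := pu k; rewrite !big_ord_recl big_ord0 /bump /=.
by rewrite !mul1n !addnS !addn0 mulr1 !mulrA.
Qed.

(** The factors of exponents 5k + 1, 5k + 4, 5k + 5 are each divided by 1 - q^j with the same
    exponent j. Since 10k + 3 and 10k + 7 are odd, q -> -q turns their factors into 1 + q^j; these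
    may be divided by 1 - q^(5k+2) and 1 - q^(5k+3) without any cancellation. *)
Lemma Q0_quot N n : nneg_quot N (euler 1 (5 * n)) (Q0 n (- 'X)).
Proof.
apply: nneg_quot_block => k.
have o3 : odd (10 * k + 3) by lia.
have o7 : odd (10 * k + 7) by lia.
set a1 := 1 - 'X^(5 * k + 1); set a2 := 1 - 'X^(5 * k + 2).
set a3 := 1 - 'X^(5 * k + 3); set a4 := 1 - 'X^(5 * k + 4).
set a5 := 1 - 'X^(5 * k + 5).
rewrite (_ : a1 * a2 * a3 * a4 * a5 = a1 * a4 * a5 * a2 * a3); last by ring.
apply: nneg_quotM; first apply: nneg_quotM;
  first apply: nneg_quotM; first apply: nneg_quotM.
- by apply: nneg_quot_1D; lia.
- by apply: nneg_quot_1D; lia.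
- by apply: nneg_quot_1B; lia.
- by apply: nneg_quot_fact; [lia|apply: nneg_1B_odd].
- by apply: nneg_quot_fact; [lia|apply: nneg_1B_odd].
Qed.

(** As for [Q0], now with 5k + 2, 5k + 3, 5k + 5 paired and 10k + 1, 10k + 9 odd. *)
Lemma Q2_quot N n : nneg_quot N (euler 1 (5 * n)) (Q2 n (- 'X)).
Proof.
apply: nneg_quot_block => k.
have o1 : odd (10 * k + 1) by lia.
have o9 : odd (10 * k + 9) by lia.
set a1 := 1 - 'X^(5 * k + 1); set a2 := 1 - 'X^(5 * k + 2).
set a3 := 1 - 'X^(5 * k + 3); set a4 := 1 - 'X^(5 * k + 4).
set a5 := 1 - 'X^(5 * k + 5).
rewrite (_ : a1 * a2 * a3 * a4 * a5 = a2 * a3 * a5 * a1 * a4); last by ring.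
apply: nneg_quotM; first apply: nneg_quotM;
  first apply: nneg_quotM; first apply: nneg_quotM.
- by apply: nneg_quot_1D; lia.
- by apply: nneg_quot_1D; lia.
- by apply: nneg_quot_1B; lia.
- by apply: nneg_quot_fact; [lia|apply: nneg_1B_odd].
- by apply: nneg_quot_fact; [lia|apply: nneg_1B_odd].
Qed.

(** A truncation of f_5(-q); the middle component, f_25 at -q, is its image under q -> q^5. *)
Definition Q1 (n : nat) : {poly int} := \prod_(k < n) (1 - (- 'X) ^+ (5 * k + 5)).

Lemma Q1_quot N n : nneg_quot N (euler 1 (5 * n)) (Q1 n).
Proof.
apply: nneg_quot_block => k; rewrite -[1 - (- 'X) ^+ _]mul1r.
apply: nneg_quotM; last by apply: nneg_quot_1B; lia.
have f r : nneg_quot N (1 - 'X^(5 * k + r.+1)) 1.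
  by apply: nneg_quot_fact nneg_poly1; lia.
have := nneg_quotM (nneg_quotM (nneg_quotM (f 0%N) (f 1%N)) (f 2%N)) (f 3%N).
by rewrite !mulr1.
Qed.

Lemma coef0_prod1 (I : Type) (r : seq I) (F : I -> {poly int}) :
  (forall k, (F k)`_0 = 1) -> (\prod_(k <- r) F k)`_0 = 1.
Proof.
move=> F1; apply: (big_ind (fun p : {poly int} => p`_0 = 1)) => //.
  by rewrite coef1.
by move=> p q p1 q1; rewrite coef0M p1 q1 mulr1.
Qed.

Lemma coef0_NX d : (0 < d)%N -> ((- 'X) ^+ d : {poly int})`_0 = 0.
Proof. by case: d => // d _; rewrite exprS mulNr coefN coefXM oppr0. Qed.

Lemma Q0_0 n : (Q0 n (- 'X))`_0 = 1.
Proof.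
apply: coef0_prod1 => k; rewrite !coef0M !coefB !coefD !coef1 !coef0_NX //; lia.
Qed.

Lemma Q1_0 n : (Q1 n)`_0 = 1.
Proof. by apply: coef0_prod1 => k; rewrite coefB coef1 coef0_NX // addnS. Qed.

Lemma Q2_0 n : (Q2 n (- 'X))`_0 = 1.
Proof.
apply: coef0_prod1 => k; rewrite !coef0M !coefB !coefD !coef1 !coef0_NX //; lia.
Qed.

Lemma coef_geom1 N i : (i < N)%N -> (geom N 1)`_i = 1.
Proof.
move=> ltiN; rewrite /geom coef_sum (bigD1 (Ordinal ltiN)) //= -exprM mul1n coefXn.
rewrite eqxx big1 ?addr0 // => j; rewrite -exprM mul1n coefXn -val_eqE /= eq_sym.
by case: eqP.
Qed.

(* The first of the two factors 1/euler absorbs the negative factors of [Q], the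
   second one contributes 1/(1 - X), which makes every coefficient positive. *)
Lemma pos_quot N n (Q : {poly int}) : (0 < N)%N -> (0 < n)%N -> Q`_0 = 1 ->
  nneg_quot N (euler 1 n) Q ->
  exists2 Y : {poly int}, (forall i, (i < N)%N -> 0 < Y`_i) &
    eqm N (euler 1 n ^+ 2 * Y) Q.
Proof.
move=> N_gt0; case: n => // n _ Q1 [V VP EV].
(* This divides [V] by (1 - q^2) (1 - q^3) ..., the factor 1 / (1 - q) being kept apart as
   [geom N 1]. *)
pose W := V * \prod_(k < n) geom N (1 * k.+2).
have W_ge0 : nneg_poly W.
  apply: nneg_polyM => //; apply: big_ind; first exact: nneg_poly1.
    exact: nneg_polyM.
  by move=> k _; apply: nneg_poly_geom.
have EW : eqm N (euler 1 n.+1 ^+ 2 * (geom N 1 * W)) Q.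
  rewrite -EV; have := @euler_inv N 1 n.+1 isT.
  rewrite big_ord_recl /=.
  rewrite (_ : _ ^+ 2 * _ = euler 1 n.+1 * V * (euler 1 n.+1 * (geom N (1 * 1) *
    \prod_(i < n) geom N (1 * (bump 0 i).+1)))).
    by move=> ->; rewrite mulr1.
  by rewrite /W muln1; ring.
exists (geom N 1 * W) => // i ltiN.
clearbody W; have W0 : 0 < W`_0.
  rewrite lt_neqAle W_ge0 andbT eq_sym; apply/eqP => W0.
  have /eqm_coef/(_ 0%N N_gt0) := EW; rewrite Q1 !coef0M W0 !mulr0 => /eqP.
  by rewrite eq_sym oner_eq0.
(* The last term of the convolution is the constant term of [W], which is positive; the others are
   nonnegative. *)
rewrite coefM big_ord_recr /= subnn coef_geom1 // mul1r.
rewrite ltr_wpDl // sumr_ge0 // => j _; rewrite mulr_ge0 //.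
exact: nneg_poly_geom.
Qed.

(** * The substitutions q -> q^e and q -> -q *)

Lemma comp_euler d e n : euler d n \Po 'X^e = euler (e * d) n.
Proof.
rewrite /euler rmorph_prod; apply: eq_bigr => k _.
by rewrite rmorphB rmorph1 /= comp_Xn_poly -exprM mulnA.
Qed.

(** The substitution sends q^5 to -q^5, whence [Q0] and [Q2] at [- 'X], and q to -q, whence the
    changed sign of the middle term. *)
Lemma euler_negX_dissection N n : (N + N <= n)%N ->
  eqm N (euler 1 n \Po - 'X)
    ((Q0 n (- 'X) \Po 'X^5) + 'X * (Q1 n \Po 'X^5) - 'X^2 * (Q2 n (- 'X) \Po 'X^5)).
Proof.
move=> leNn; have NX0 : (- 'X : {poly int})`_0 = 0 by rewrite coefN coefX oppr0.
rewrite (eqm_comp NX0 (euler_dissection leNn)); apply: eq_eqm.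
rewrite !rmorphB !rmorphM /= !Q0_comp !Q2_comp !rmorphN /= !comp_Xn_poly !comp_polyX.
have -> : euler 25 n \Po - 'X = Q1 n \Po 'X^5.
  rewrite /euler /Q1 !rmorph_prod; apply: eq_bigr => k _.
  rewrite !rmorphB !rmorph1 !rmorphXn /= rmorphN /= !comp_polyX; congr (_ - _).
  rewrite -['X^5]opprK -[- 'X^5](_ : (- 'X) ^+ 5 = _); last by rewrite exprNX.
  by rewrite opprK -exprM; congr (_ ^+ _); lia.
rewrite [(- 'X) ^+ 5]exprNX /=; ring.
Qed.

(** With these lengths f_1(-q) f_1 f_4 = f_2^3 holds exactly: in the block of exponents 2k + 1 and
    2k + 2, (1 + q^(2k+1)) (1 - q^(2k+1)) = 1 - q^(2(2k+1)), and the other factors agree. *)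
Lemma euler_negX m :
  (euler 1 (2 * m) \Po - 'X) * euler 1 (2 * m) * euler 4 m =
  euler 2 m ^+ 2 * euler 2 (2 * m).
Proof.
rewrite /euler rmorph_prod /=.
under eq_bigr => k _ do rewrite rmorphB rmorph1 /= comp_Xn_poly mul1n.
rewrite (prod_blocks 2 m (fun k => 1 - (- 'X) ^+ k.+1 : {poly int})).
rewrite (prod_blocks 2 m (fun k => 1 - 'X^(1 * k.+1) : {poly int})).
rewrite (prod_blocks 2 m (fun k => 1 - 'X^(2 * k.+1) : {poly int})).
rewrite -prodrXl -!big_split; apply: eq_bigr => k _ /=.
rewrite !big_ord_recl !big_ord0 /bump /= !mulr1 !mul1n addn0 addn1 !exprNX /= oddM /=.
rewrite (_ : 4 * k.+1 = 2 * (2 * k).+2)%N; last by lia.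
rewrite (_ : 2 * k.+1 = (2 * k).+2)%N; last by lia.
rewrite !(mulnC 2 _.+1) !exprM; ring.
Qed.

(** * Coefficients of the series *)

Definition truncates (N : nat) (p : {poly int}) (a : fps) :=
  forall i, (i < N)%N -> p`_i = a i.

Lemma truncates_poly N (a : fps) : truncates N (\poly_(i < N) a i) a.
Proof. by move=> i ltiN; rewrite coef_poly ltiN. Qed.

Lemma truncates1 N : truncates N 1 fps_one.
Proof. by move=> i _; rewrite coef1. Qed.

Lemma truncatesM N p q a b :
  truncates N p a -> truncates N q b -> truncates N (p * q) (a * b)%fps.
Proof.
move=> pa qb i ltiN; rewrite coefM; apply: eq_bigr => j _.
by rewrite pa ?qb //; have := ltn_ord j; lia.
Qed.

Lemma truncatesX N p a m : truncates N p a -> truncates N (p ^+ m) (a ^+ m)%fps.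
Proof.
move=> pa; elim: m => [|m IHm]; first exact: truncates1.
by rewrite exprS; apply: truncatesM.
Qed.

Lemma truncates_eulerf N j : (0 < j)%N -> truncates N (euler j N) 'f_j%fps.
Proof.
move=> j_gt0 i ltiN; rewrite -(@eulerf_stable j i N) //; last exact: ltnW.
by rewrite /eulerf_trunc big_add1 big_mkord.
Qed.

(** Each of [Y0], [Y1], [Y2] is a component of f_1(-q) divided by f_1^2. The substitution of q^5
    turns f_1^2 into f_5^2, the denominator left once f_2^3 = f_1(-q) f_1 f_4 is used. *)
Lemma a_dissection N : (0 < N)%N ->
  exists Y0 Y1 Y2 : {poly int},
    [/\ forall i, (i < N)%N -> 0 < Y0`_i, forall i, (i < N)%N -> 0 < Y1`_i,
        forall i, (i < N)%N -> 0 < Y2`_i &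
        forall i, (i < N)%N -> a_1m1_2p3_4m1_5m2 i =
          ((Y0 \Po 'X^5) + 'X * (Y1 \Po 'X^5) - 'X^2 * (Y2 \Po 'X^5))`_i].
Proof.
(* The dissection needs N + N <= n, and [euler_negX] an even number of factors. *)
move=> N_gt0; pose n := (2 * N)%N.
have n5_gt0 : (0 < 5 * n)%N by lia.
have [Y0 Y0_gt0 E0] := pos_quot N_gt0 n5_gt0 (Q0_0 n) (Q0_quot N n).
have [Y1 Y1_gt0 E1] := pos_quot N_gt0 n5_gt0 (Q1_0 n) (Q1_quot N n).
have [Y2 Y2_gt0 E2] := pos_quot N_gt0 n5_gt0 (Q2_0 n) (Q2_quot N n).
exists Y0, Y1, Y2; split=> //.
set Y : {poly int} := _ + _ - _.
pose den : fps := ('f_1 * 'f_4 * 'f_5 ^+ 2)%fps.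
pose v : {poly int} := \poly_(i < N) fps_inv den i.
pose D := euler 1 N * euler 4 N * euler 5 N ^+ 2.
have DT : truncates N D den.
  apply: truncatesM; first by apply: truncatesM; apply: truncates_eulerf.
  by apply/truncatesX/truncates_eulerf.
have den0 : den 0%N = 1.
  rewrite -DT // !coef0M.
  by rewrite !(truncates_eulerf _ N_gt0) // !eulerf0 !mulr1.
have Dv : eqm N (D * v) 1.
  apply/eqm_coef => i ltiN.
  rewrite (truncatesM DT (truncates_poly _)) // fps_mulV ?den0 ?unitr1 //.
  by rewrite coef1.
have aT : truncates N (euler 2 N ^+ 3 * v) a_1m1_2p3_4m1_5m2.
  apply: truncatesM (truncates_poly _).
  by apply/truncatesX/truncates_eulerf.
suff /eqm_coef aY : eqm N (euler 2 N ^+ 3 * v) Y.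
  by move=> i ltiN; rewrite -aT // aY.
have X5_0 : ('X^5 : {poly int})`_0 = 0 by rewrite coefXn.
have FY : eqm N (euler 1 n \Po - 'X) (euler 5 N ^+ 2 * Y).
  rewrite euler_negX_dissection; last by lia.
  have dil Q : eqm N (euler 1 (5 * n) ^+ 2 * Q \Po 'X^5)
      (euler 5 N ^+ 2 * (Q \Po 'X^5)).
    rewrite rmorphM rmorphXn /= comp_euler muln1 !expr2.
    by rewrite (@euler_stable N 5 (5 * n) N) //; lia.
  rewrite -(eqm_comp X5_0 E0) -(eqm_comp X5_0 E1) -(eqm_comp X5_0 E2) !dil.
  by apply: eq_eqm; rewrite /Y; ring.
have E2E : eqm N (euler 2 N ^+ 3) ((euler 1 n \Po - 'X) * euler 1 N * euler 4 N).
  rewrite (@euler_stable N 1 N n) //; last by lia.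
  rewrite euler_negX exprSr.
  by rewrite (@euler_stable N 2 n N) //; lia.
rewrite E2E FY.
rewrite (_ : _ * _ = Y * (D * v)); last by rewrite /D; ring.
by rewrite Dv mulr1.
Qed.

Lemma coef_comp_X5 (Y : {poly int}) n c r : (c < 5)%N -> (r < 5)%N ->
  ('X^c * (Y \Po 'X^5))`_(5 * n + r) = if r == c then Y`_n else 0.
Proof.
move=> lt_c5 lt_r5; rewrite coefXnM coef_comp_poly_Xn //.
case: eqVneq => [->|neq_rc]; first by rewrite addnK ltnNge leq_addl dvdn_mulr ?mulKn.
case: ltnP => // le_c; case: ifP => // /dvdnP[k]; lia.
Qed.

Theorem theorem5p2 (n : nat) :
  [/\ 0 < a_1m1_2p3_4m1_5m2 (5 * n)%N,
      0 < a_1m1_2p3_4m1_5m2 (5 * n + 1)%N,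
      a_1m1_2p3_4m1_5m2 (5 * n + 2)%N < 0,
      a_1m1_2p3_4m1_5m2 (5 * n + 3)%N = 0
    & a_1m1_2p3_4m1_5m2 (5 * n + 4)%N = 0].
Proof.
(* Truncation at 5n + 5 keeps all five coefficients. *)
have [Y0 [Y1 [Y2 [Y0_gt0 Y1_gt0 Y2_gt0 aE]]]] := a_dissection (ltn0Sn (5 * n + 4)).
have ltn : (n < (5 * n + 4).+1)%N by lia.
have aE' r : (r < 5)%N -> a_1m1_2p3_4m1_5m2 (5 * n + r)%N =
    (if r == 0%N then Y0`_n else 0) + (if r == 1%N then Y1`_n else 0)
    - (if r == 2%N then Y2`_n else 0).
  move=> lt_r5; rewrite aE; last by lia.
  have := @coef_comp_X5 Y0 n 0 r isT lt_r5; rewrite mul1r => c0.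
  have := @coef_comp_X5 Y1 n 1 r isT lt_r5; rewrite expr1 => c1.
  by rewrite coefB coefD c0 c1 coef_comp_X5.
split.
- by have := aE' 0%N isT; rewrite addn0 => ->; rewrite /= addr0 subr0 Y0_gt0.
- by rewrite aE' //= add0r subr0 Y1_gt0.
- by rewrite aE' //= addr0 sub0r oppr_lt0 Y2_gt0.
- by rewrite aE' //= addr0 subr0.
- by rewrite aE' //= addr0 subr0.
Qed.
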